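(* Let $L:\mathbb{R}^n\times\mathbb{R}^m\to[-\infty,+\infty]$ be such that $L(\cdot,\lambda)$ is convex and lower semicontinuous for every $\lambda$ and $L(x,\cdot)$ is concave and upper semicontinuous for every $x$, and consider the convex-concave primal-dual problem $\min_x\max_\lambda L(x,\lambda)$ with bounded constraint region $Z\subset\mathbb{R}^n\times\mathbb{R}^m$ of diameter $D=\sup_{z,z'\in Z}\|z-z'\|_2$. Let $P\in\mathbb{R}^{(n+m)\times(n+m)}$ be a (symmetric) positive semidefinite matrix, let $z^0=(x^0,\lambda^0)\in\mathbb{R}^{n+m}$, and let $z^k=(x^k,\lambda^k)\in Z$, $k\ge1$, and errors $\epsilon^k\in\mathbb{R}^{n+m}$, $k\ge1$, satisfy $$P(z^k-z^{k+1})+\epsilon^{k+1}\in\mathcal{F}(z^{k+1})\qquad\text{for all }k\ge0.$$ Set $\bar z^k=(\bar x^k,\bar\lambda^k)=\frac1k\sum_{i=1}^kz^i$. Then for every $k\ge1$ and every $z=(x,\lambda)\in Z$, $$L(\bar x^k,\lambda)-L(x,\bar\lambda^k)\le\frac{\|z-z^0\|_P^2}{2k}+\frac{D\sum_{i=1}^k\|\epsilon^i\|_2}{k}.$$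
   Context: For $z=(x,\lambda)$, $\mathcal{F}(z)=\begin{pmatrix}\partial_xL(x,\lambda)\\-\partial_\lambda L(x,\lambda)\end{pmatrix}$, where $\partial_xL(x,\lambda)$ is the convex subdifferential of $L(\cdot,\lambda)$ at $x$ and $-\partial_\lambda L(x,\lambda)$ is the convex subdifferential of $-L(x,\cdot)$ at $\lambda$; subdifferentials are taken only at points where $L$ is finite. The constraints of the problem are understood to be incorporated in $L$ through the values $\pm\infty$. For a positive semidefinite $P$, $\|z\|_P^2=z^TPz$. *)

(* Defs.v *)
From mathcomp Require Import all_boot all_order all_algebra.
From mathcomp Require Import all_classical all_reals all_analysis.

Set Implicit Arguments.
Unset Strict Implicit.
Unset Printing Implicit Defensive.

Import Order.TTheory GRing.Theory Num.Theory.
Import numFieldNormedType.Exports.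

Local Open Scope classical_set_scope.
Local Open Scope ring_scope.

Section Euclidean.
Context {R : realType} {d : nat}.

Definition dotp (u v : 'cV[R]_d) : R := (u^T *m v) 0 0.

(* The library norm on matrices is the max norm, so the Euclidean norm is
   defined here. *)
Definition norm2 (v : 'cV[R]_d) : R := Num.sqrt (dotp v v).

Definition diameter (Z : set 'cV[R]_d) : R :=
  sup [set norm2 (z - z') | z in Z & z' in Z].

Definition sqnormP (P : 'M[R]_d) (v : 'cV[R]_d) : R := dotp v (P *m v).

Definition psdmx (P : 'M[R]_d) : Prop :=
  P^T = P /\ forall v : 'cV[R]_d, 0 <= sqnormP P v.

(* Functions take values in [-oo, +oo] and may be improper, so convexity is
   convexity of the epigraph: no sum of opposite infinities arises. *)
Definition epigraph (f : 'cV[R]_d -> \bar R) : set ('cV[R]_d * R^o)%type :=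
  [set p | (f p.1 <= p.2%:E)%E].

Definition ereal_convex (f : 'cV[R]_d -> \bar R) : Prop :=
  convex_set (epigraph f).

Definition ereal_concave (f : 'cV[R]_d -> \bar R) : Prop :=
  ereal_convex (fun v => - f v)%E.

Definition upper_semicontinuous (f : 'cV[R]_d -> \bar R) : Prop :=
  lower_semicontinuous (fun v => - f v)%E.

(* Empty at points where f is infinite. *)
Definition subdifferential (f : 'cV[R]_d -> \bar R) (v : 'cV[R]_d) :
    set 'cV[R]_d :=
  [set g | f v \is a fin_num /\
           forall w, (f v + (dotp g (w - v))%:E <= f w)%E].

Definition ergodic_avg (z : nat -> 'cV[R]_d) (k : nat) : 'cV[R]_d :=
  k%:R^-1 *: \sum_(1 <= i < k.+1) z i.

End Euclidean.

(* A primal-dual point z = (x, lambda) is the stacked column vector with upper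
   block x = usubmx z and lower block lambda = dsubmx z. *)
Definition saddle_op {R : realType} {n m : nat}
    (L : 'cV[R]_n -> 'cV[R]_m -> \bar R) (z : 'cV[R]_(n + m)) :
    set 'cV[R]_(n + m) :=
  [set col_mx u v |
     u in subdifferential (fun x => L x (dsubmx z)) (usubmx z) &
     v in subdifferential (fun l => - L (usubmx z) l)%E (dsubmx z)].

(* Main.v *)
Require Import Defs.
From mathcomp Require Import all_boot all_order all_algebra.
From mathcomp Require Import all_classical all_reals all_analysis.
From mathcomp Require Import ring lra.

(** The bound is a telescoping argument on the distance to the comparison
    point zs = (x, l), carried by three facts.

    A pair of subgradients g of L at z = (x', l') linearises both blocks from
    the same finite value L(x', l'): it bounds L(x', l) and - L(x, l') above by
    two reals whose sum is <g, z - zs>, because that common value cancels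
    ([saddle_op_gap]).

    Averaging these upper bounds by Jensen's inequality, in the first block for
    L(., l) and in the second for - L(x, .), gives the same estimate at the
    ergodic average, with the mean of the <g_i, z_i - zs> on the right
    ([ergodic_gap_le]).  Both halves are bounded above by reals, so the
    difference on the left never combines opposite infinities.

    Finally g_i = P (z_(i-1) - z_i) + eps_i.  For the first term, the
    three-point identity of the form P gives at most half the decrease of the
    squared P-distance to zs ([prox_step_le]), which telescopes; the second is
    at most D times the norm of eps_i by Cauchy-Schwarz, as z_i and zs both lie
    in Z ([dotp_le_norm2], [norm2_le_diameter]). *)

Set Implicit Arguments.
Unset Strict Implicit.
Unset Printing Implicit Defensive.

Import Order.TTheory GRing.Theory Num.Theory.
Import numFieldNormedType.Exports.

Local Open Scope classical_set_scope.
Local Open Scope ring_scope.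

Section EuclideanTheory.
Context {R : realType} {d : nat}.
Implicit Types (u v w : 'cV[R]_d) (P : 'M[R]_d).

Lemma dotpE u v : dotp u v = \sum_i u i 0 * v i 0.
Proof. by rewrite /dotp mxE; apply: eq_bigr => i _; rewrite mxE. Qed.

Lemma dotpC u v : dotp u v = dotp v u.
Proof. by rewrite !dotpE; apply: eq_bigr => i _; rewrite mulrC. Qed.

Lemma dotpDl u v w : dotp (u + v) w = dotp u w + dotp v w.
Proof. by rewrite /dotp linearD mulmxDl mxE. Qed.

Lemma dotpDr u v w : dotp u (v + w) = dotp u v + dotp u w.
Proof. by rewrite dotpC dotpDl ![dotp _ u]dotpC. Qed.

Lemma dotpZl a u v : dotp (a *: u) v = a * dotp u v.
Proof. by rewrite /dotp linearZ -scalemxAl mxE. Qed.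

Lemma dotpZr a u v : dotp u (a *: v) = a * dotp u v.
Proof. by rewrite dotpC dotpZl dotpC. Qed.

Lemma dotpNr u v : dotp u (- v) = - dotp u v.
Proof. by rewrite -scaleN1r dotpZr mulN1r. Qed.

Lemma dotp_ge0 u : 0 <= dotp u u.
Proof. by rewrite dotpE; apply: sumr_ge0 => i _; rewrite -expr2 sqr_ge0. Qed.

Lemma dotp_eq0 u : dotp u u = 0 -> u = 0.
Proof.
rewrite dotpE => /eqP; rewrite psumr_eq0; last first.
  by move=> i _; rewrite -expr2 sqr_ge0.
move=> /allP u0; apply/matrixP => i j; rewrite ord1 mxE.
by have := u0 i (mem_index_enum i); rewrite /= mulf_eq0 orbb => /eqP.
Qed.

(** Cauchy-Schwarz: with a = <u, u>, b = <u, v> and c = <v, v>, the squared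
    length of c u - b v is c (a c - b^2), so it is enough that c > 0; the
    remaining case is v = 0. *)
Lemma dotp_le_norm2 u v : dotp u v <= norm2 u * norm2 v.
Proof.
rewrite /norm2 -sqrtrM ?dotp_ge0//.
apply: le_trans (ler_norm _) _; rewrite -sqrtr_sqr; apply: ler_wsqrtr.
have [c0|c_neq0] := eqVneq (dotp v v) 0.
  by rewrite (dotp_eq0 c0) dotpC -(scale0r v) !dotpZl !mul0r expr0n mulr0.
have c_gt0 : 0 < dotp v v by rewrite lt_neqAle eq_sym c_neq0 dotp_ge0.
have -> : dotp u v ^+ 2 <= dotp u u * dotp v v =
    (0 <= dotp v v * (dotp u u * dotp v v - dotp u v ^+ 2)).
  by rewrite pmulr_rge0// subr_ge0.
apply: le_trans (dotp_ge0 (dotp v v *: u + (- dotp u v) *: v)) _.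
rewrite !(dotpDl, dotpDr, dotpZl, dotpZr) (dotpC v u) le_eqVlt.
by apply/orP; left; apply/eqP; ring.
Qed.

(** Boundedness of a set refers to the max norm of matrices, the diameter to the
    Euclidean norm; this comparison makes the set of distances bounded above. *)
Lemma norm2_le_mx_norm v : norm2 v <= Num.sqrt (d%:R * `|v| ^+ 2).
Proof.
apply: ler_wsqrtr; rewrite dotpE mulr_natl -[X in _ *+ X]card_ord -sumr_const.
apply: ler_sum => i _; rewrite -expr2 -real_normK ?num_real//.
rewrite lerXn2r ?nnegrE// {2}/Num.norm/= mx_normrE.
exact: (le_bigmax _ (fun ij : 'I_d * 'I_1 => `|v ij.1 ij.2|) (i, 0)).
Qed.

(** The diameter is a supremum of reals, which bounds its set only when that set
    has an upper bound: this is where boundedness of [Z] enters. *)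
Lemma norm2_le_diameter (Z : set 'cV[R]_d) u v :
  bounded_set Z -> Z u -> Z v -> norm2 (u - v) <= diameter Z.
Proof.
move=> /ex_strict_bound_gt0[M M_gt0 ZM] Zu Zv.
apply: ub_le_sup; last by exists u => //; exists v.
exists (Num.sqrt (d%:R * (M + M) ^+ 2)) => _ [x Zx [y Zy <-]].
apply: le_trans (norm2_le_mx_norm _) _; apply: ler_wsqrtr.
rewrite ler_wpM2l// lerXn2r ?nnegrE ?addr_ge0 ?(ltW M_gt0)//.
by apply: le_trans (ler_normB _ _) _; rewrite lerD// ltW// ZM.
Qed.

Lemma sqnormPN P v : sqnormP P (- v) = sqnormP P v.
Proof. by rewrite /sqnormP mulmxN dotpNr dotpC dotpNr opprK dotpC. Qed.

Lemma sqnormPD P u v : P^T = P ->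
  sqnormP P (u + v) = sqnormP P u + 2 * dotp (P *m u) v + sqnormP P v.
Proof.
move=> PT; rewrite /sqnormP mulmxDr !dotpDl !dotpDr.
have -> : dotp u (P *m v) = dotp (P *m u) v.
  by rewrite /dotp trmx_mul PT mulmxA.
by rewrite (dotpC v (P *m u)); ring.
Qed.

(** Expanding the squared seminorm of u - w = (u - v) + (v - w) gives the exact
    difference of the two sides, half the squared seminorm of u - v. *)
Lemma prox_step_le P u v w : psdmx P ->
  dotp (P *m (u - v)) (v - w) <= (sqnormP P (u - w) - sqnormP P (v - w)) / 2.
Proof.
move=> [PT P_ge0]; rewrite ler_pdivlMr// mulrC.
have -> : u - w = (u - v) + (v - w) by rewrite addrA subrK.
by rewrite sqnormPD//; have := P_ge0 (u - v); lra.
Qed.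

End EuclideanTheory.

Section Averages.
Context {R : realType}.

(** The average of k + 1 points is the convex combination, with weights
    k / (k + 1) and 1 / (k + 1), of the average of the first k and the last. *)
Lemma convex_set_avg {V : lmodType R} {A : set V} {p : nat -> V} {k : nat} :
  convex_set A -> (1 <= k)%N -> (forall i, (1 <= i)%N -> A (p i)) ->
  A (k%:R^-1 *: \sum_(1 <= i < k.+1) p i).
Proof.
move=> A_convex k_gt0 Ap; elim: k k_gt0 => // -[_ _|k IHk _].
  by rewrite invr1 scale1r big_nat1; apply: Ap.
have k2_gt0 : 0 < k.+2%:R :> R by [].
have t_ge0 : 0 <= k.+1%:R / k.+2%:R :> R by rewrite divr_ge0.
have t_le1 : k.+1%:R / k.+2%:R <= 1 :> R.
  by rewrite ler_pdivrMr// mul1r ler_nat.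
have onem_t : 1 - k.+1%:R / k.+2%:R = k.+2%:R^-1 :> R.
  rewrite -[X in X - _](mulfV (lt0r_neq0 k2_gt0)) -mulrBl -natrB//.
  by rewrite subSnn mul1r.
have /set_mem := A_convex (k.+1%:R^-1 *: \sum_(1 <= i < k.+2) p i)
  (p k.+2) (Itv01 t_ge0 t_le1) (mem_set (IHk isT)) (mem_set (Ap k.+2 isT)).
rewrite /conv/= (big_nat_recr k.+2)//=; congr A.
rewrite scalerDr scalerA; congr (_ *: _ + _ *: _).
  by rewrite mulrAC mulfV ?mul1r.
exact: onem_t.
Qed.

(** Jensen's inequality in epigraph form.  The values f (y i) are replaced by
    real upper bounds because they may be -oo, and an average of values in the
    extended line would need a side condition. *)
Lemma ereal_convex_avg_le {d : nat} {f : 'cV[R]_d -> \bar R}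
    {y : nat -> 'cV[R]_d} {b : nat -> R} {k : nat} :
  ereal_convex f -> (1 <= k)%N ->
  (forall i, (1 <= i)%N -> (f (y i) <= (b i)%:E)%E) ->
  (f (ergodic_avg y k) <= (k%:R^-1 * \sum_(1 <= i < k.+1) b i)%:E)%E.
Proof.
move=> f_convex k_gt0 fb.
have := @convex_set_avg _ _ (fun i => (y i, b i)) _ f_convex k_gt0 fb.
rewrite /epigraph/= /ergodic_avg.
rewrite (big_morph fst (id1 := 0) (op1 := +%R))//.
by rewrite (big_morph snd (id1 := 0) (op1 := +%R)).
Qed.

End Averages.

Section SaddleOperator.
Context {R : realType} {n m : nat} {L : 'cV[R]_n -> 'cV[R]_m -> \bar R}.

(** The two bounds are the linearisations of L(., l') and - L(x', .) at
    z = (x', l'), rearranged.  They are kept apart, as Jensen's inequality is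
    applied to each block separately; only their sum is free of the value
    L(x', l'). *)
Lemma saddle_op_gap {z g : 'cV[R]_(n + m)} (x : 'cV[R]_n) (l : 'cV[R]_m) :
  saddle_op L z g -> exists bc : R * R,
    [/\ (L (usubmx z) l <= bc.1%:E)%E, (- L x (dsubmx z) <= bc.2%:E)%E
      & bc.1 + bc.2 = dotp g (z - col_mx x l)].
Proof.
move=> [u [Lfin Lu] [v [_ Lv] <-]].
pose a := fine (L (usubmx z) (dsubmx z)).
have La : L (usubmx z) (dsubmx z) = a%:E by rewrite fineK.
exists (a - dotp v (l - dsubmx z), - a - dotp u (x - usubmx z)); split => /=.
(* Since [v] is a subgradient of - L(x', .), it bounds L(x', .) from above,
   whereas [u] bounds L(., l') from below: the roles of the blocks cross. *)
- move: (Lv l); rewrite La; case: (L _ l) => [r| |] //=; rewrite ?leNye//.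
  by rewrite !lee_fin; lra.
- move: (Lu x); rewrite La; case: (L x _) => [r| |] //=; rewrite ?leNye//.
  by rewrite !lee_fin; lra.
- rewrite -[in RHS](vsubmxK z) opp_col_mx add_col_mx.
  rewrite [in RHS]/dotp tr_col_mx mul_row_col mxE -!/(dotp _ _).
  by rewrite !dotpDr !dotpNr; ring.
Qed.

Lemma ergodic_gap_le {z g : nat -> 'cV[R]_(n + m)} {k : nat}
    (x : 'cV[R]_n) (l : 'cV[R]_m) :
  (forall l, ereal_convex (fun x => L x l)) ->
  (forall x, ereal_concave (L x)) ->
  (forall i, (1 <= i)%N -> saddle_op L (z i) (g i)) -> (1 <= k)%N ->
  let xbar := usubmx (ergodic_avg z k) in
  let lbar := dsubmx (ergodic_avg z k) in
  (L xbar l +? - L x lbar)%E /\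
  (L xbar l - L x lbar <=
    (k%:R^-1 * \sum_(1 <= i < k.+1) dotp (g i) (z i - col_mx x l))%:E)%E.
Proof.
move=> L_convex L_concave zg k_gt0 xbar lbar.
(* At index 0 no subgradient is given, so the bounds there are arbitrary. *)
have /choice[bc bcP] : forall i, exists bc : R * R, (1 <= i)%N ->
    [/\ (L (usubmx (z i)) l <= bc.1%:E)%E, (- L x (dsubmx (z i)) <= bc.2%:E)%E
      & bc.1 + bc.2 = dotp (g i) (z i - col_mx x l)].
  move=> [|i]; first by exists (0, 0).
  by have [bc bcP] := saddle_op_gap x l (zg i.+1 isT); exists bc.
have xbarE : xbar = ergodic_avg (fun i => usubmx (z i)) k.
  by rewrite /xbar /ergodic_avg linearZ linear_sum.
have lbarE : lbar = ergodic_avg (fun i => dsubmx (z i)) k.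
  by rewrite /lbar /ergodic_avg linearZ linear_sum.
have Lx : (L xbar l <= (k%:R^-1 * \sum_(1 <= i < k.+1) (bc i).1)%:E)%E.
  rewrite xbarE; apply: (ereal_convex_avg_le (L_convex l) k_gt0) => i.
  by case/bcP.
have Ll : (- L x lbar <= (k%:R^-1 * \sum_(1 <= i < k.+1) (bc i).2)%:E)%E.
  rewrite lbarE; apply: (ereal_convex_avg_le (L_concave x) k_gt0) => i.
  by case/bcP.
split.
  apply: ltpinfty_adde_def; rewrite inE.
    exact: le_lt_trans Lx (ltry _).
  exact: le_lt_trans Ll (ltry _).
have -> : \sum_(1 <= i < k.+1) dotp (g i) (z i - col_mx x l) =
    \sum_(1 <= i < k.+1) (bc i).1 + \sum_(1 <= i < k.+1) (bc i).2.
  by rewrite -big_split/=; apply: eq_big_nat => i /andP[/bcP[_ _ ->]].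
by rewrite mulrDr EFinD leeD.
Qed.

End SaddleOperator.

Theorem theorem3 (R : realType) (n m : nat)
    (L : 'cV[R]_n -> 'cV[R]_m -> \bar R)
    (L_convex : forall l, ereal_convex (fun x => L x l))
    (L_lsc : forall l, lower_semicontinuous (fun x => L x l))
    (L_concave : forall x, ereal_concave (L x))
    (L_usc : forall x, upper_semicontinuous (L x))
    (Z : set 'cV[R]_(n + m)) (Z_bounded : bounded_set Z)
    (P : 'M[R]_(n + m)) (P_psd : psdmx P)
    (z eps : nat -> 'cV[R]_(n + m))
    (zZ : forall k, (1 <= k)%N -> Z (z k))
    (z_step : forall k,
      saddle_op L (z k.+1) (P *m (z k - z k.+1) + eps k.+1)) :
  forall (k : nat) (x : 'cV[R]_n) (l : 'cV[R]_m),
    (1 <= k)%N -> Z (col_mx x l) ->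
    let xbar := usubmx (ergodic_avg z k) in
    let lbar := dsubmx (ergodic_avg z k) in
    (L xbar l +? - L x lbar)%E /\
    (L xbar l - L x lbar <=
       (sqnormP P (col_mx x l - z 0%N) / (2 * k%:R)
        + diameter Z * (\sum_(1 <= i < k.+1) norm2 (eps i)) / k%:R)%:E)%E.
Proof.
move=> k x l k_gt0 Zxl xbar lbar; set zs := col_mx x l.
pose g i := P *m (z i.-1 - z i) + eps i.
have zg i : (1 <= i)%N -> saddle_op L (z i) (g i).
  by case: i => // i _; apply: z_step.
have [Ldef Lgap] := ergodic_gap_le x l L_convex L_concave zg k_gt0.
split=> //; apply: le_trans Lgap _; rewrite lee_fin.
have step i : (1 <= i)%N -> dotp (g i) (z i - zs) <=
    (sqnormP P (z i.-1 - zs) - sqnormP P (z i - zs)) / 2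
    + diameter Z * norm2 (eps i).
  move=> i_gt0; rewrite dotpDl lerD ?prox_step_le//.
  apply: le_trans (dotp_le_norm2 _ _) _; rewrite mulrC.
  by rewrite ler_wpM2r ?sqrtr_ge0// norm2_le_diameter//; apply: zZ.
(* The last term of the telescoping sum, - |z_k - zs|_P^2 / 2, is dropped, as P
   is positive semidefinite. *)
have tele : \sum_(1 <= i < k.+1)
    (sqnormP P (z i.-1 - zs) - sqnormP P (z i - zs)) / 2 <=
    sqnormP P (zs - z 0%N) / 2.
  rewrite -mulr_suml ler_pM2r// big_add1/=.
  under eq_bigr do rewrite -opprB.
  rewrite sumrN telescope_sumr// opprB.
  rewrite -[in leRHS]opprB sqnormPN.
  by have := P_psd.2 (z k - zs); lra.
rewrite invfM mulrA -mulrDl mulrC ler_pM2r ?invr_gt0 ?ltr0n//.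
apply: le_trans (_ : \sum_(1 <= i < k.+1)
   ((sqnormP P (z i.-1 - zs) - sqnormP P (z i - zs)) / 2
    + diameter Z * norm2 (eps i)) <= _).
  by rewrite big_nat [leRHS]big_nat; apply: ler_sum => i /andP[/step].
by rewrite big_split/= -mulr_sumr lerD2r.
Qed.
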